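(* Let $a<b$ be positive even integers. An infinite smooth word $w$ over $\{a,b\}$ is an infinite Lyndon word if and only if $w=m_{\{a<b\}}$.
   Context: Words over $\{a,b\}$ are compared lexicographically with $a<b$. For a word $w$ over $\{a,b\}$ written as maximal blocks $\alpha_0^{i_0}\alpha_1^{i_1}\cdots$ ($\alpha_{k+1}\ne\alpha_k$, $i_k\ge1$), $\Delta(w)=i_0i_1\cdots$. An infinite word $w\in\{a,b\}^\omega$ is smooth if $\Delta^k(w)\in\{a,b\}^\omega$ for all $k\ge0$. $m_{\{a<b\}}$ is the lexicographically minimal infinite smooth word over $\{a,b\}$. An infinite Lyndon word is an infinite word strictly smaller than each of its proper suffixes. *)

(* Defs.v *)
From mathcomp Require Import all_boot zify.
From Stdlib Require Import ClassicalEpsilon FunctionalExtensionality.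

Set Implicit Arguments.
Unset Strict Implicit.
Unset Printing Implicit Defensive.

(* Infinite words.  The letters are natural numbers, so that the run-length
   encoding of a word is again a word; alphabets are imposed by [word_over]. *)
Definition word := nat -> nat.

Definition word_over (a b : nat) (w : word) : Prop :=
  forall i, w i = a \/ w i = b.

Definition word_suffix (n : nat) (w : word) : word := fun i => w (n + i).

Definition lex_lt (u v : word) : Prop :=
  exists n, (forall i, i < n -> u i = v i) /\ u n < v n.

Definition lex_le (u v : word) : Prop := u = v \/ lex_lt u v.

(* Starting position of the k-th block when the block lengths are u 0, u 1, ... *)
Definition block_start (u : word) (k : nat) : nat := \sum_(j < k) u j.

(* [is_Delta w u] means Delta(w) = u.  Delta is a partial function on infinite
   words (an eventually constant word has only finitely many blocks), hence is
   given by its graph; functionality is [is_Delta_inj] below. *)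
Definition is_Delta (w u : word) : Prop :=
  [/\ forall k, 0 < u k,
      forall k i, i < u k -> w (block_start u k + i) = w (block_start u k)
    & forall k, w (block_start u k.+1) <> w (block_start u k)].

(* [is_Delta_iter k w u] means Delta^k(w) = u. *)
Fixpoint is_Delta_iter (k : nat) (w u : word) : Prop :=
  if k is k'.+1 then exists v, is_Delta w v /\ is_Delta_iter k' v u
  else w = u.

Definition smooth (a b : nat) (w : word) : Prop :=
  forall k, exists u, is_Delta_iter k w u /\ word_over a b u.

Definition is_min_smooth (a b : nat) (m : word) : Prop :=
  smooth a b m /\ forall w, smooth a b w -> lex_le m w.

(* The lexicographically minimal infinite smooth word over {a, b}; it exists and
   is unique whenever 0 < a < b, see [min_smoothP] and [is_min_smooth_inj]. *)
Definition min_smooth (a b : nat) : word :=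
  epsilon (inhabits (fun=> a)) (is_min_smooth a b).

Definition infinite_Lyndon (w : word) : Prop :=
  forall n, 0 < n -> lex_lt w (word_suffix n w).

Lemma block_startS u k : block_start u k.+1 = block_start u k + u k.
Proof. by rewrite /block_start big_ord_recr. Qed.

Lemma eq_block_start u u' k :
  (forall j, j < k -> u j = u' j) -> block_start u k = block_start u' k.
Proof. by move=> e; apply: eq_bigr => j _; apply: e. Qed.

Lemma block_start_le u k b : (forall j, u j <= b) -> block_start u k <= k * b.
Proof.
move=> ub; elim: k => [|k IH]; first by rewrite /block_start big_ord0.
by rewrite block_startS mulSn; have := ub k; lia.
Qed.

Lemma is_Delta_lt w u u' v k :
  is_Delta w u -> is_Delta v u' ->
  (forall j, j < k -> u j = u' j) ->
  (forall i, i <= block_start u k + u k -> w i = v i) -> u' k <= u k.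
Proof.
move=> [_ wc wn] [_ vc _] e ag; rewrite leqNgt; apply/negP => lt.
apply: (wn k); rewrite block_startS !ag; last 2 first.
- by rewrite leq_addr.
- by [].
by rewrite (eq_block_start e) vc.
Qed.

Lemma is_Delta_agree w v u u' n :
  is_Delta w u -> is_Delta v u' ->
  (forall j, j < n -> forall i, i <= block_start u j + u j -> w i = v i) ->
  (forall j, j < n -> forall i, i <= block_start u' j + u' j -> w i = v i) ->
  forall j, j < n -> u j = u' j.
Proof.
move=> D D' ag ag'; elim/ltn_ind => j IH jn.
have e i : i < j -> u i = u' i by move=> ij; apply: IH => //; lia.
have h1 := is_Delta_lt D D' e (ag _ jn).
have h2 : u j <= u' j.
  apply: (is_Delta_lt D' D) => [i ij|i le]; first by rewrite e.
  by rewrite (ag' _ jn).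
by lia.
Qed.

Lemma is_Delta_inj w u u' : is_Delta w u -> is_Delta w u' -> u = u'.
Proof.
move=> D D'; apply: functional_extensionality => j.
exact: (@is_Delta_agree w w u u' j.+1).
Qed.

Lemma is_Delta_agree_bounded w v u u' b n :
  is_Delta w u -> is_Delta v u' ->
  (forall j, u j <= b) -> (forall j, u' j <= b) ->
  (forall i, i <= n * b -> w i = v i) -> forall j, j < n -> u j = u' j.
Proof.
have bd x j : (forall j, x j <= b) -> j < n -> block_start x j + x j <= n * b.
  move=> xb jn; rewrite -block_startS.
  by apply: leq_trans (block_start_le _ xb) _; rewrite leq_mul2r jn orbT.
move=> D D' ub u'b ag; apply: (is_Delta_agree D D') => j jn i le; apply: ag;
  exact: leq_trans le (bd _ _ _ jn).
Qed.

Lemma lex_lt_asym u v : lex_lt u v -> ~ lex_lt v u.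
Proof.
move=> [n [e lt]] [p [e' lt']].
case: (ltngtP n p) => [h|h|h]; [have := e' _ h|have := e _ h|subst]; lia.
Qed.

Lemma is_min_smooth_inj a b m m' :
  is_min_smooth a b m -> is_min_smooth a b m' -> m = m'.
Proof.
move=> [s h] [s' h']; case: (h _ s') => // lt; case: (h' _ s) => // lt'.
by case: (lex_lt_asym lt lt').
Qed.

Lemma smooth_over a b w : smooth a b w -> word_over a b w.
Proof. by move=> /(_ 0) [u [/= -> ]]. Qed.

Lemma smooth_Delta a b w : smooth a b w -> exists u, is_Delta w u /\ smooth a b u.
Proof.
move=> s; have [_ [[u [D /= _]] _]] := s 1; exists u; split => // k.
have [x [[u' [D' it]] ov]] := s k.+1.
by exists x; split => //; rewrite (is_Delta_inj D D').
Qed.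

Section Existence.

Variables a b : nat.
Hypotheses (a_gt0 : 0 < a) (lt_ab : a < b).

Let over_le w : word_over a b w -> forall j, w j <= b.
Proof. by move=> ov j; case: (ov j) => ->; lia. Qed.

(* A word which is its own run-length encoding. *)
Let c k := if odd k then a else b.
Fixpoint kol_prefix (k : nat) : seq nat :=
  if k is k'.+1 then kol_prefix k' ++ nseq (nth b (kol_prefix k') k') (c k')
  else [::].
Definition kol : word := fun n => nth b (kol_prefix n.+1) n.

Let kol_in k i : nth b (kol_prefix k) i = a \/ nth b (kol_prefix k) i = b.
Proof.
elim: k i => [|k IH] i; first by rewrite nth_nil; right.
rewrite /= nth_cat; case: ifP => // _; rewrite nth_nseq /c.
by case: ifP => _; [case: (odd k); [left|right]|right].
Qed.

Let kol_size k : k < size (kol_prefix k.+1).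
Proof.
elim: k => [|k IH]; first by rewrite /= size_nseq; lia.
rewrite [kol_prefix k.+2]/= -/(kol_prefix k.+1) size_cat size_nseq.
by case: (kol_in k.+1 k.+1) => /= ->; rewrite /= in IH; lia.
Qed.

Let kol_stable k d i : i < size (kol_prefix k) ->
  i < size (kol_prefix (d + k)) /\
  nth b (kol_prefix (d + k)) i = nth b (kol_prefix k) i.
Proof.
move=> lt; elim: d => [|d [IH1 IH2]] //.
by rewrite addSn /= nth_cat size_cat IH1 IH2; split => //; lia.
Qed.

Let kolE k i : i < size (kol_prefix k) -> kol i = nth b (kol_prefix k) i.
Proof.
move=> lt; have [_ <-] := kol_stable i.+1 lt.
by rewrite addnC; have [_ ->] := kol_stable k (kol_size i).
Qed.

Let kol_next k : nth b (kol_prefix k) k = kol k.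
Proof.
case: k => [|k]; first by rewrite /kol /= nth_nseq; case: ifP.
case: (ltnP k.+1 (size (kol_prefix k.+1))) => h; first by rewrite (kolE h).
exfalso; have := h; apply/negP; rewrite -ltnNge; elim: k {h} => [|k IH].
  by rewrite /= size_nseq; lia.
rewrite [kol_prefix k.+2]/= -/(kol_prefix k.+1) size_cat size_nseq.
by case: (kol_in k.+1 k.+1) => /= ->; rewrite /= in IH; lia.
Qed.

Let kol_start k : block_start kol k = size (kol_prefix k).
Proof.
elim: k => [|k IH]; first by rewrite /block_start big_ord0.
by rewrite block_startS IH /= size_cat size_nseq kol_next.
Qed.

Let kol_over : word_over a b kol. Proof. by move=> i; apply: kol_in. Qed.

Let kol_block k i : i < kol k -> kol (block_start kol k + i) = c k.
Proof.
move=> lt; rewrite (@kolE k.+1); last first.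
  by rewrite /= size_cat size_nseq kol_next kol_start; lia.
rewrite /= nth_cat kol_start ltnNge leq_addr /= addKn nth_nseq kol_next.
by rewrite lt.
Qed.

Let kol_gt0 k : 0 < kol k. Proof. by case: (kol_over k) => ->; lia. Qed.

Let kol_block0 k : kol (block_start kol k) = c k.
Proof. by rewrite -(kol_block (kol_gt0 k)) addn0. Qed.

Lemma kol_Delta : is_Delta kol kol.
Proof.
split=> [|k i lt|k]; first exact: kol_gt0.
- by rewrite kol_block // kol_block0.
- by rewrite !kol_block0 /c /=; case: (odd k) => /=; lia.
Qed.

Lemma kol_smooth : smooth a b kol.
Proof.
move=> k; exists kol; split; last exact: kol_over.
by elim: k => [|k IH] //=; exists kol; split => //; exact: kol_Delta.
Qed.

(* The set of smooth words is closed. *)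
Let adherent w :=
  forall n, exists v, smooth a b v /\ forall i, i <= n -> v i = w i.

Let adherent_over w : adherent w -> word_over a b w.
Proof.
by move=> ad i; have [v [/smooth_over ov <-]] := ad i.
Qed.

Let adherent_Delta w : adherent w -> exists u, is_Delta w u /\ adherent u.
Proof.
move=> ad.
have approx n : exists p : word * word,
    [/\ smooth a b p.1, is_Delta p.1 p.2, smooth a b p.2
      & forall i, i <= n * b -> p.1 i = w i].
  have [v [s e]] := ad (n * b); have [u [D s']] := smooth_Delta s.
  by exists (v, u).
pose f n := proj1_sig (constructive_indefinite_description _ (approx n)).
have fP n : [/\ smooth a b (f n).1, is_Delta (f n).1 (f n).2, smooth a b (f n).2
      & forall i, i <= n * b -> (f n).1 i = w i].
  exact: proj2_sig (constructive_indefinite_description _ (approx n)).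
pose u : word := fun k => (f k.+1).2 k.
have uE n k : k < n -> u k = (f n).2 k.
  move=> lt; have [s1 D1 s1' e1] := fP k.+1; have [s2 D2 s2' e2] := fP n.
  apply: (is_Delta_agree_bounded D1 D2 (over_le (smooth_over s1'))
            (over_le (smooth_over s2')) _ (ltnSn k)) => i le.
  rewrite e1 // e2 //; apply: leq_trans le _.
  by rewrite leq_mul2r lt orbT.
have stE n k : k <= n -> block_start u k = block_start (f n).2 k.
  by move=> le; apply: eq_block_start => j lt; apply: uE; lia.
exists u; split; last first.
  move=> n; exists (f n.+1).2; have [_ _ s _] := fP n.+1.
  by split => // i le; rewrite (uE n.+1).
have wE k i : i <= block_start u k.+1 -> w i = (f k.+2).1 i.
  have [_ _ s e] := fP k.+2 => le; rewrite e //.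
  rewrite (stE k.+2) // in le.
  apply: leq_trans le _.
  apply: leq_trans (block_start_le _ (over_le (smooth_over s))) _.
  by rewrite leq_mul2r leqnSn orbT.
have le_start k : block_start u k <= block_start u k.+1.
  by rewrite block_startS leq_addr.
split=> [k|k i lt|k].
- by have [_ [h _ _] _ _] := fP k.+1; apply: h.
- have le : block_start u k + i <= block_start u k.+1 by rewrite block_startS; lia.
  rewrite (wE _ _ le) (wE _ _ (le_start k)) (stE k.+2); last by lia.
  have [_ [_ h _] _ _] := fP k.+2; apply: h.
  by rewrite -uE.
- rewrite (wE k _ (leqnn _)) (wE k _ (le_start k)).
  rewrite (stE k.+2 k.+1) // (stE k.+2 k); last by lia.
  by have [_ [_ _ h] _ _] := fP k.+2.
Qed.

Let adherent_smooth w : adherent w -> smooth a b w.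
Proof.
move=> ad k.
suff [u [it /adherent_over ov]] : exists u, is_Delta_iter k w u /\ adherent u.
  by exists u.
elim: k w ad => [|k IH] w ad; first by exists w.
have [v [D adv]] := adherent_Delta ad; have [u [it adu]] := IH _ adv.
by exists u; split => //=; exists v.
Qed.

Let extends (p : seq nat) :=
  exists v, smooth a b v /\ forall i, i < size p -> v i = nth 0 p i.

Fixpoint greedy (n : nat) : seq nat :=
  if n is n'.+1 then
    rcons (greedy n')
      (if excluded_middle_informative (extends (rcons (greedy n') a))
       then a else b)
  else [::].

Let size_greedy n : size (greedy n) = n.
Proof. by elim: n => //= n IH; rewrite size_rcons IH. Qed.

Let rcons_agree n (v : word) x :
  (forall i, i < n -> v i = nth 0 (greedy n) i) -> v n = x ->
  forall i, i < size (rcons (greedy n) x) -> v i = nth 0 (rcons (greedy n) x) i.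
Proof.
move=> e vn i; rewrite size_rcons size_greedy ltnS nth_rcons size_greedy.
by case: ltngtP => // [h _|-> _]; [exact: e|].
Qed.

Let greedy_extends n : extends (greedy n).
Proof.
elim: n => [|n [v [s e]]]; first by exists kol; split => //; exact: kol_smooth.
rewrite size_greedy in e.
rewrite /=; case: excluded_middle_informative => // nE.
exists v; split => //; apply: rcons_agree => //.
case: (smooth_over s n) => // vn; case: nE; exists v; split => //.
exact: rcons_agree.
Qed.

Let m : word := fun n => nth 0 (greedy n.+1) n.

Let mE n i : i < n -> nth 0 (greedy n) i = m i.
Proof.
elim: n => // n IH; rewrite ltnS leq_eqVlt => /orP[/eqP -> //|lt].
by rewrite /= nth_rcons size_greedy lt IH.
Qed.

Lemma ex_min_smooth : exists m, is_min_smooth a b m.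
Proof.
exists m; split.
  apply: adherent_smooth => n; have [v [s e]] := greedy_extends n.+1.
  exists v; split => // i le.
  by rewrite e ?size_greedy // (@mE n.+1).
move=> w s; case: (excluded_middle_informative (exists n, m n != w n)); last first.
  move=> h; left; apply: functional_extensionality => n.
  by apply/eqP/negPn/negP => ne; apply: h; exists n.
move=> ex; right; case: (ex_minnP ex) => n ne mn; exists n.
have e i : i < n -> m i = w i.
  move=> lt; apply/eqP/negPn/negP => /mn; lia.
split=> //.
have mab : m n = a /\ w n <> a \/ m n = b /\ ~ extends (rcons (greedy n) a).
  move: ne; rewrite /m /= nth_rcons size_greedy ltnn eqxx.
  case: (excluded_middle_informative _) => E ne; last by right.
  by left; split => // wn; rewrite wn eqxx in ne.
case: mab => [[-> wn]|[mn' nE]]; first by case: (smooth_over s n) => [|->].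
case: (smooth_over s n) => wn; last by rewrite mn' wn eqxx in ne.
case: nE; exists w; split => //; apply: rcons_agree => // i lt.
by rewrite mE // e.
Qed.

End Existence.

Lemma min_smoothP a b : 0 < a -> a < b -> is_min_smooth a b (min_smooth a b).
Proof. by move=> a0 ab; apply: epsilon_spec; apply: ex_min_smooth. Qed.

(* Main.v *)
Require Import Defs.
From mathcomp Require Import all_boot zify.
From Stdlib Require Import Classical FunctionalExtensionality.

Set Implicit Arguments.
Unset Strict Implicit.
Unset Printing Implicit Defensive.

(** Over an even alphabet every block of a smooth word has even length, so a
    smooth word reads [x0 x0 x1 x1 x2 x2 ...] and two smooth words (or suffixes
    of smooth words at even positions) first differ at an even position.  Blocks
    of even index all carry the first letter of the word, so among words
    starting with [b] the operator Delta preserves and reflects the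
    lexicographic order.  By induction on positions, the word [K = kol a b],
    which starts with [b] and satisfies Delta(K) = K, is larger than all its
    proper suffixes and is the largest smooth word.  Conversely, for a smooth
    word [u] being larger than all proper suffixes at even positions forces
    [u 0 = b] and is inherited by Delta(u), which forces [u = K].  Exchanging the
    letters [a] and [b] leaves Delta unchanged and reverses the order, so the
    minimal smooth word is the complement of [K]. *)

(** * Lexicographic comparison, suffixes and blocks *)

Lemma first_diff (u v : word) :
  u = v \/ exists2 n, (forall i, i < n -> u i = v i) & u n <> v n.
Proof.
have [h|h] := classic (exists n, u n != v n); last first.
  left; apply: functional_extensionality => n.
  by apply/eqP/negPn/negP => ne; apply: h; exists n.
right; case: (ex_minnP h) => n ne mn; exists n; last by apply/eqP.
by move=> i lt; apply/eqP/negPn/negP => /mn; lia.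
Qed.

Lemma lex_total (u v : word) : [\/ u = v, lex_lt u v | lex_lt v u].
Proof.
have [->|[n e ne]] := first_diff u v; first by constructor 1.
case: (ltngtP (u n) (v n)) => // h; [constructor 2|constructor 3]; exists n => //.
by split=> // i /e.
Qed.

Lemma lex_lt_irrefl (u : word) : ~ lex_lt u u.
Proof. by move=> [n [_]]; rewrite ltnn. Qed.

Lemma word_over_suffix a b p (u : word) :
  word_over a b u -> word_over a b (word_suffix p u).
Proof. by move=> ov i; apply: ov. Qed.

Lemma block_start_suffix (u : word) p k :
  block_start u (p + k) = block_start u p + block_start (word_suffix p u) k.
Proof.
elim: k => [|k IH]; first by rewrite addn0 {3}/block_start big_ord0 addn0.
by rewrite addnS !block_startS IH addnA.
Qed.

Lemma block_split (u : word) n : (forall k, 0 < u k) ->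
  exists j i, i < u j /\ n = block_start u j + i.
Proof.
move=> u0; elim: n => [|n [j [i [lt ->]]]].
  by exists 0, 0; rewrite /block_start big_ord0.
have [lt'|ge] := ltnP i.+1 (u j); first by exists j, i.+1; split; lia.
by exists j.+1, 0; split; rewrite ?block_startS //; lia.
Qed.

Lemma is_Delta_suffix (w u : word) p : is_Delta w u ->
  is_Delta (word_suffix (block_start u p) w) (word_suffix p u).
Proof.
move=> [u0 wc wn]; split=> [k|k i lt|k]; rewrite /word_suffix //.
- by rewrite addnA -!block_start_suffix; apply: wc.
- by rewrite -!block_start_suffix addnS; apply: wn.
Qed.

(** Adjacent blocks carry different letters and only two letters exist, so the letters of the blocks
    alternate. *)
Lemma is_Delta_block_letter a b (w u : word) k :
  word_over a b w -> is_Delta w u ->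
  (w (block_start u k) == w 0) = ~~ odd k.
Proof.
move=> ov [_ _ wn]; elim: k => [|k IH]; first by rewrite /block_start big_ord0 eqxx.
rewrite /= -IH; move: (wn k).
case: (ov (block_start u k.+1)) (ov (block_start u k)) (ov 0) => [] -> [] -> [] -> ne;
  by do 2 case: eqP => //; congruence.
Qed.

(** The first letter fixes the letter of every block, by parity of its index. The bound includes the
    start of block [k], whose letter is known even where its length is not. *)
Lemma is_Delta_agree_inv a b (w u w' u' : word) k :
  word_over a b w -> word_over a b w' -> w 0 = w' 0 ->
  is_Delta w u -> is_Delta w' u' ->
  (forall i, i < k -> u i = u' i) ->
  forall i, i <= block_start u k -> w i = w' i.
Proof.
move=> ov ov' e0 D D' e.
have start j : j <= k -> w (block_start u j) = w' (block_start u j).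
  move=> le; have -> : w' (block_start u j) = w' (block_start u' j).
    by congr w'; apply: eq_block_start => i lt; apply: e; lia.
  have := is_Delta_block_letter j ov' D'; rewrite -e0 -(is_Delta_block_letter j ov D).
  case: (ov (block_start u j)) (ov' (block_start u' j)) (ov 0) => [] -> [] -> [] ->;
    by do 2 case: eqP => //; congruence.
move=> i; elim: k e start => [|k IH] e start.
  by rewrite /block_start big_ord0 leqn0 => /eqP ->.
rewrite leq_eqVlt => /orP[/eqP -> | ]; first exact: start.
have [le _|gt] := leqP i (block_start u k).
  by apply: IH => // j lt; [apply: e | apply: start]; lia.
rewrite block_startS => lt.
have [_ wc _] := D; have [_ wc' _] := D'.
have -> : i = block_start u k + (i - block_start u k) by lia.
rewrite wc; last by lia.
rewrite start // (@eq_block_start u u' k); last by move=> j lj; apply: e; lia.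
rewrite wc' // -e // (@eq_block_start u' u k); first by lia.
by move=> j lj; rewrite e //; lia.
Qed.

(** * Words in which each letter is doubled *)

Definition doubled (u : word) : Prop := forall i, u i.*2.+1 = u i.*2.

Lemma doubled_suffix p (u : word) :
  ~~ odd p -> doubled u -> doubled (word_suffix p u).
Proof.
move=> ev d i; rewrite /word_suffix addnS.
by have -> : p + i.*2 = (p./2 + i).*2 by lia.
Qed.

Lemma doubled_diff_even (u v : word) n : doubled u -> doubled v ->
  (forall i, i < n -> u i = v i) -> u n <> v n -> ~~ odd n.
Proof.
move=> du dv e ne; apply/negP => od; apply: ne.
have -> : n = n./2.*2.+1 by lia.
by rewrite du dv e //; lia.
Qed.

Lemma block_start_even (u : word) k :
  (forall i, ~~ odd (u i)) -> ~~ odd (block_start u k).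
Proof.
move=> ev; elim: k => [|k IH]; first by rewrite /block_start big_ord0.
by rewrite block_startS oddD (negPf IH) ev.
Qed.

(** Block starts and lengths are even, so an even position has an even offset in its block and its
    successor lies in the same block. *)
Lemma is_Delta_doubled (w u : word) :
  is_Delta w u -> (forall i, ~~ odd (u i)) -> doubled w.
Proof.
move=> [u0 wc _] ev n; have [j [i [lt E]]] := block_split n.*2 u0.
have := ev j; have := block_start_even j ev => evs evj.
by rewrite E -addnS !wc //; lia.
Qed.

(** * Monotonicity of Delta over an even alphabet *)

Section EvenAlphabet.

Variables a b : nat.
Hypotheses (a_gt0 : 0 < a) (lt_ab : a < b) (even_a : ~~ odd a) (even_b : ~~ odd b).

(** The first difference [k] of [u] and [u'] is even, so block [k] consists of [b] in both words;
    where the shorter one ends, [w] has [a] and [w'] still has [b]. *)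
Lemma is_Delta_lex_lt (w u w' u' : word) :
  word_over a b w -> word_over a b w' -> w 0 = b -> w' 0 = b ->
  is_Delta w u -> is_Delta w' u' -> doubled u -> doubled u' ->
  lex_lt u u' -> lex_lt w w'.
Proof.
move=> ov ov' w0 w'0 D D' du du' [k [e lt]].
have ev : ~~ odd k by apply: (doubled_diff_even du du') => //; lia.
have ag := is_Delta_agree_inv ov ov' (etrans w0 (esym w'0)) D D' e.
have [_ wc wn] := D; have [_ wc' _] := D'.
have bs := eq_block_start e.
have wk : w (block_start u k) = b.
  by apply/eqP; rewrite -w0 (is_Delta_block_letter k ov D).
have w'k : w' (block_start u' k) = b.
  by apply/eqP; rewrite -w'0 (is_Delta_block_letter k ov' D').
exists (block_start u k.+1); split=> [i|].
  rewrite block_startS => lti.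
  have [le|gt] := leqP i (block_start u k); first exact: ag.
  have E : i = block_start u k + (i - block_start u k) by lia.
  rewrite E wc; last by lia.
  by rewrite bs wc' -?bs; [rewrite bs -w'k in wk *; congruence | lia].
have -> : w' (block_start u k.+1) = b by rewrite block_startS bs wc'.
by have := wn k; rewrite wk; case: (ov (block_start u k.+1)) => ->.
Qed.

Lemma word_over_even u : word_over a b u -> forall i, ~~ odd (u i).
Proof. by move=> ov i; case: (ov i) => ->. Qed.

Lemma word_over_ge2 u i : word_over a b u -> 2 <= u i.
Proof. by move=> ov; have := word_over_even ov i; case: (ov i) => ->; lia. Qed.

Lemma block_start_ge u k : word_over a b u -> k.*2 <= block_start u k.
Proof.
move=> ov; elim: k => // k IH; rewrite block_startS.
by have := word_over_ge2 k ov; lia.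
Qed.

Lemma smooth_doubled u : smooth a b u -> doubled u.
Proof.
move=> s; have [v [D /smooth_over ov]] := smooth_Delta s.
exact: is_Delta_doubled D (word_over_even ov).
Qed.

(** * Maximality of the self-encoding word *)

Local Notation K := (kol a b).

Lemma kol0 : K 0 = b.
Proof. by rewrite /kol /= nth_nseq; case: (0 < b). Qed.

Let K_smooth : smooth a b K. Proof. exact: kol_smooth. Qed.
Let K_over : word_over a b K. Proof. exact: smooth_over K_smooth. Qed.
Let K_Delta : is_Delta K K. Proof. exact: kol_Delta. Qed.

(** Strong induction on [p]: for a suffix starting at the beginning of a block of [b], Delta yields
    the suffix of [K] at the index [j] of that block, and [j < p]. *)
Lemma kol_suffix_lt p : 0 < p -> lex_lt (word_suffix p K) K.
Proof.
elim/ltn_ind: p => p IH p0; have [K0 Kc Kn] := K_Delta.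
case: (K_over p) => Kp.
  by exists 0; split=> //; rewrite /word_suffix addn0 Kp kol0.
have [j [i [lt E]]] := block_split p K0.
have Kj : K (block_start K j) = b by rewrite -(Kc j i lt) -E.
(* The opening block of [K] has length [K 0 = b]. *)
have Kpre t : t < b -> K t = b.
  rewrite -{1}kol0 => /Kc; rewrite /block_start big_ord0 add0n => ->.
  exact: kol0.
case: (posnP i) => [i0|i0].
  have Ep : p = block_start K j by rewrite E i0 addn0.
  have j0 : 0 < j.
    by case: (j) Ep => // Ep; move: p0; rewrite Ep /block_start big_ord0.
  have evj : ~~ odd j.
    by rewrite -(is_Delta_block_letter j K_over K_Delta) Kj kol0.
  have ltj : j < p by have := block_start_ge j K_over; lia.
  apply: (@is_Delta_lex_lt _ (word_suffix j K) _ K) => //.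
  - exact: word_over_suffix.
  - by rewrite /word_suffix addn0.
  - exact: kol0.
  - by rewrite Ep; apply: is_Delta_suffix.
  - exact: doubled_suffix evj (smooth_doubled K_smooth).
  - exact: smooth_doubled.
  - exact: IH.
have le_b : K j <= b by case: (K_over j) => ->; lia.
(* The suffix starts inside a block of [b]: after the [K j - i < b] letters left there it has [a],
   while [K] is still in its opening block. *)
exists (K j - i); split=> [s lts|].
  rewrite /word_suffix (Kpre s); last by lia.
  by rewrite E -addnA Kc //; lia.
rewrite /word_suffix (Kpre (K j - i)); last by lia.
have -> : p + (K j - i) = block_start K j.+1 by rewrite block_startS; lia.
by have := Kn j; rewrite Kj; case: (K_over (block_start K j.+1)) => ->.
Qed.

(** Each application of Delta gains a position: [n] common block lengths fix [u] up to the start of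
    block [n], which is at least [n]. *)
Lemma kol_Delta_agree u v n : smooth a b u -> is_Delta u v -> u 0 = b ->
  (forall i, i < n -> v i = K i) -> forall i, i <= n -> u i = K i.
Proof.
move=> s D u0 e i le; have ov := smooth_over s.
have [v' [D' s']] := smooth_Delta s; rewrite (is_Delta_inj D' D) in s'.
apply: (is_Delta_agree_inv ov K_over _ D K_Delta e); first by rewrite u0 kol0.
by have := block_start_ge n (smooth_over s'); lia.
Qed.

(** Induction on [n] for all [u] at once, applied to Delta(u) at its first difference [k] from [K].
    If [k < n], monotonicity of Delta concludes; otherwise [u] and [K] agree at [n]. *)
Lemma smooth_agree_le_kol n u : smooth a b u ->
  (forall i, i < n -> u i = K i) -> u n <= K n.
Proof.
elim/ltn_ind: n u => n IH u s e.
have [->|n0] := posnP n.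
  by rewrite kol0; case: (smooth_over s 0) => ->; lia.
have u0 : u 0 = b by rewrite e // kol0.
have [v [D s']] := smooth_Delta s.
have [vK|[k ek nk]] := first_diff v K; last first.
  have [ltk|lek] := ltnP k n; last first.
    by rewrite (kol_Delta_agree s D u0 ek).
  have ltv : lex_lt v K by exists k; split=> //; have := IH k ltk v s' ek; lia.
  have [p [ep ltp]] : lex_lt u K.
    apply: (@is_Delta_lex_lt _ v _ K) => //; try exact: smooth_doubled.
      exact: smooth_over.
    exact: kol0.
  case: (ltngtP p n) => [h|h|<-]; last exact: ltnW.
    by rewrite e // ltnn in ltp.
  by rewrite ep.
by rewrite (@kol_Delta_agree u v n s D u0) // vK.
Qed.

Lemma smooth_le_kol u : smooth a b u -> ~ lex_lt K u.
Proof.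
move=> s [n [e lt]]; have := @smooth_agree_le_kol n u s.
by rewrite leqNgt lt => h; have : false by apply: h => i /e.
Qed.

(** * Smooth words above all their even suffixes *)

Definition even_suffix_max (u : word) : Prop :=
  forall p, 0 < p -> ~~ odd p -> lex_lt (word_suffix p u) u.

(** Otherwise the second block, which starts at the even position [v 0], would begin a larger
    suffix. *)
Lemma even_suffix_max_head u : smooth a b u -> even_suffix_max u -> u 0 = b.
Proof.
move=> s mx; have ov := smooth_over s; have [v [D s']] := smooth_Delta s.
have ovv := smooth_over s'; have [_ _ un] := D.
case: (ov 0) => // u0.
have := un 0; rewrite block_startS /block_start big_ord0 add0n u0 => ne.
have ub : u (v 0) = b by case: (ov (v 0)).
have [|n [e lt]] := mx (v 0) _ (word_over_even ovv 0).
  by have := word_over_ge2 0 ovv; lia.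
case: n e lt => [_|n e _]; first by rewrite /word_suffix addn0 ub u0; lia.
by have := e 0 isT; rewrite /word_suffix addn0 ub u0; lia.
Qed.

(** For even [p], block [p] of [u] carries [b] and starts at an even position [q]. A suffix of [v]
    at [p] equal to or above [v] would put the suffix of [u] at [q] equal to or above [u]. *)
Lemma even_suffix_max_Delta u v : smooth a b u -> smooth a b v -> is_Delta u v ->
  even_suffix_max u -> even_suffix_max v.
Proof.
move=> s s' D mx p p0 ev; have u0 := even_suffix_max_head s mx.
have ov := smooth_over s; have ovv := smooth_over s'.
have Dp := is_Delta_suffix p D; set q := block_start v p in Dp.
have q0 : 0 < q by have := block_start_ge p ovv; rewrite /q; lia.
have ltq := mx q q0 (block_start_even p (word_over_even ovv)).
have ovq := @word_over_suffix a b q u ov.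
have uq0 : word_suffix q u 0 = b.
  by apply/eqP; rewrite /word_suffix addn0 -u0 (is_Delta_block_letter p ov D).
have dv := smooth_doubled s'; have dp := doubled_suffix ev dv.
case: (lex_total (word_suffix p v) v) => // [E|lt].
  have E' : word_suffix q u = u.
    apply: functional_extensionality => i.
    apply: (@is_Delta_agree_inv a b _ _ _ _ i ovq ov _ Dp D).
    - by rewrite uq0 u0.
    - by move=> j _; rewrite E.
    - by rewrite E; have := block_start_ge i ovv; lia.
  by rewrite E' in ltq; case: (lex_lt_irrefl ltq).
case: (lex_lt_asym ltq).
exact: (@is_Delta_lex_lt u v (word_suffix q u) (word_suffix p v)).
Qed.

Lemma even_suffix_max_kol u : smooth a b u -> even_suffix_max u -> u = K.
Proof.
move=> s mx; apply: functional_extensionality => n.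
suff: forall i, i <= n -> u i = K i by apply.
elim: n u s mx => [|n IH] u s mx; have u0 := even_suffix_max_head s mx.
  by move=> i; rewrite leqn0 => /eqP ->; rewrite u0 kol0.
have [v [D s']] := smooth_Delta s.
apply: (kol_Delta_agree s D u0) => i lt.
by apply: IH => //; apply: even_suffix_max_Delta mx.
Qed.

(** * Exchange of the two letters *)

Definition complement (u : word) : word := fun i => a + b - u i.

Lemma complement_over u : word_over a b u -> word_over a b (complement u).
Proof. by move=> ov i; rewrite /complement; case: (ov i) => ->; lia. Qed.

Lemma complementK u : word_over a b u -> complement (complement u) = u.
Proof.
move=> ov; apply: functional_extensionality => i.
by rewrite /complement; case: (ov i) => ->; lia.
Qed.

Lemma complement_Delta u v :
  word_over a b u -> is_Delta u v -> is_Delta (complement u) v.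
Proof.
move=> ov [v0 uc un]; split=> // [k i lt|k]; rewrite /complement ?uc //.
have := un k; case: (ov (block_start v k)) => ->;
by case: (ov (block_start v k.+1)) => ->; lia.
Qed.

(** A word and its complement have the same Delta, so only the zeroth iterate changes. *)
Lemma complement_smooth u : smooth a b u -> smooth a b (complement u).
Proof.
move=> s; have ov := smooth_over s; have [v [D s']] := smooth_Delta s.
case=> [|k]; first by exists (complement u); split=> //; apply: complement_over.
have [x [it ovx]] := s' k; exists x; split=> //=; exists v; split=> //.
exact: complement_Delta.
Qed.

Lemma complement_lex_lt u v : word_over a b u -> word_over a b v ->
  lex_lt u v -> lex_lt (complement v) (complement u).
Proof.
move=> ov ov' [n [e lt]]; exists n; split=> [i /e|]; rewrite /complement.
  by move=> ->.
by case: (ov n) (ov' n) lt => -> [] ->; lia.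
Qed.

Lemma complement_kol_min : is_min_smooth a b (complement K).
Proof.
split=> [|w s]; first exact: complement_smooth.
have ov := smooth_over s; have ovK := complement_over K_over.
case: (lex_total (complement K) w) => [e|lt|lt]; [by left|by right|].
have := complement_lex_lt ov ovK lt; rewrite complementK // => ltK.
by case: (smooth_le_kol (complement_smooth s) ltK).
Qed.

Lemma complement_kol_Lyndon : infinite_Lyndon (complement K).
Proof.
move=> p /kol_suffix_lt lt.
exact: (complement_lex_lt (word_over_suffix p K_over) K_over lt).
Qed.

(** Complementation turns the Lyndon condition into [even_suffix_max], which forces the complement
    of [w] to be [K]. *)
Lemma Lyndon_complement_kol w :
  smooth a b w -> infinite_Lyndon w -> w = complement K.
Proof.
move=> s L; have ov := smooth_over s.
rewrite -(even_suffix_max_kol (complement_smooth s)) ?complementK // => p p0 _.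
exact: (complement_lex_lt ov (word_over_suffix p ov) (L p p0)).
Qed.

End EvenAlphabet.

Theorem theorem19 (a b : nat) (a_gt0 : 0 < a) (lt_ab : a < b)
    (even_a : ~~ odd a) (even_b : ~~ odd b) (w : word) (w_smooth : smooth a b w) :
  infinite_Lyndon w <-> w = min_smooth a b.
Proof.
have mE : min_smooth a b = complement a b (kol a b).
  by apply: (@is_min_smooth_inj a b); [apply: min_smoothP | apply: complement_kol_min].
rewrite mE; split=> [L|->]; first exact: Lyndon_complement_kol.
exact: complement_kol_Lyndon.
Qed.
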